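(* Let $G=(V,E,w)$ be a finite, connected graph with weighted edges and $n=|V|$ vertices, let $L$ be its Laplacian, and for $0<\lambda<1$ let $X_\lambda$ and $\|\cdot\|_{X_\lambda}$ be the associated function space and norm (all as defined in the context). Let $W\subset V$ be equipped with real weights $(a_w)_{w\in W}$ satisfying $\sum_{w\in W}a_w=1$. Then, for every $\ell\in\mathbb{N}$ and every $0<\lambda<1$, for all $f\in X_\lambda$, $$\left|\frac1n\sum_{v\in V}f(v)-\sum_{w\in W}a_w f(w)\right|\le\frac{\|f\|_{X_\lambda}}{\lambda^{\ell}}\left(\left\|(\mathrm{Id}_{n\times n}+L)^{\ell}\sum_{w\in W}a_w\delta_w\right\|_{L^2}^2-\frac1n\right)^{\frac12}.$$
   Context: Let $G=(V,E,w)$ be a finite connected graph with $V=\{1,\dots,n\}$ and edge weights $w(e_{ij})=w(e_{ji})\ge 0$. The weighted adjacency matrix $A$ is the symmetric $n\times n$ matrix with $A_{ij}=w(e_{ij})$ if $i$ and $j$ are joined by an edge $e_{ij}$, and $A_{ij}=0$ otherwise. Put $d_{\max}=\max_{1\le i\le n}\sum_{j=1}^nA_{ij}$, assumed positive, $A'=\frac{1}{d_{\max}}A$, let $D'$ be the diagonal matrix with $D'_{ii}=\frac{1}{d_{\max}}\sum_{j=1}^nA_{ij}$, and define the Laplacian $L=A'-D'$ (with this sign convention). Set $P=\mathrm{Id}_{n\times n}+L$, a symmetric stochastic matrix. Let $\lambda_1,\dots,\lambda_n$ be the eigenvalues of $P$ (with multiplicity), ordered so that $1=|\lambda_1|\ge|\lambda_2|\ge\dots\ge|\lambda_n|\ge0$,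 and let $\phi_1,\dots,\phi_n\in\mathbb{R}^n$ be a corresponding orthonormal basis of eigenvectors with $\phi_1=1/\sqrt n$ the constant vector. Functions $f:V\to\mathbb{R}$ are identified with vectors in $\mathbb{R}^n$; $\langle f,g\rangle=\sum_{v\in V}f(v)g(v)$ and $\|f\|_{L^2}^2=\sum_{v\in V}f(v)^2$ (no normalization by $n$). $\delta_w$ is the function equal to $1$ at $w$ and $0$ elsewhere. For $0\le\lambda\le1$, $$X_\lambda=\Big\{f:V\to\mathbb{R}\ \Big|\ f=\sum_{|\lambda_k|\ge\lambda}\langle f,\phi_k\rangle\phi_k\Big\},\qquad \|f\|_{X_\lambda}^2=\sum_{|\lambda_k|\ge\lambda}|\langle f,\phi_k\rangle|^2.$$ *)

(* Defs.v *)
From HB Require Import structures.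
From mathcomp Require Import all_boot all_order all_algebra.
From mathcomp Require Import reals.
Set Implicit Arguments.
Unset Strict Implicit.
Unset Printing Implicit Defensive.
Import Order.TTheory GRing.Theory Num.Theory.
Local Open Scope ring_scope.

(* Weights are only constrained, and only used, on edges. A weight may be zero
   on an edge, and loops are not excluded. *)
Record wgraph (R : realType) (n : nat) := WGraph {
  edge : rel 'I_n;
  weight : 'I_n -> 'I_n -> R;
  edge_sym : symmetric edge;
  weight_sym : forall i j, edge i j -> weight i j = weight j i;
  weight_ge0 : forall i j, edge i j -> 0 <= weight i j
}.

Definition connected_graph (R : realType) (n : nat) (G : wgraph R n) : Prop :=
  forall i j : 'I_n, connect (edge G) i j.

Definition adjacency (R : realType) (n : nat) (G : wgraph R n) : 'M[R]_n :=
  \matrix_(i, j) (if edge G i j then weight G i j else 0).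

Definition degree (R : realType) (n : nat) (G : wgraph R n) (i : 'I_n) : R :=
  \sum_j adjacency G i j.

(* Degrees are nonnegative, so starting the maximum at 0 does not change it. *)
Definition dmax (R : realType) (n : nat) (G : wgraph R n) : R :=
  \big[Num.max/0]_(i < n) degree G i.

Definition laplacian (R : realType) (n : nat) (G : wgraph R n) : 'M[R]_n :=
  (dmax G)^-1 *: adjacency G - diag_mx (\row_i ((dmax G)^-1 * degree G i)).

(* A function f : V -> R is a column vector, with f(v) written f v 0. *)
Definition inner (R : realType) (n : nat) (f g : 'cV[R]_n) : R :=
  \sum_v f v 0 * g v 0.

Definition l2norm (R : realType) (n : nat) (f : 'cV[R]_n) : R :=
  Num.sqrt (\sum_v f v 0 ^+ 2).

Definition dirac (R : realType) (n : nat) (w : 'I_n) : 'cV[R]_n :=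
  delta_mx w 0.

(* n orthonormal vectors of R^n form a basis, so ev lists all eigenvalues of P
   with multiplicity. The index 0 of 'I_n plays the role of k = 1. *)
Record ordered_eigenbasis (R : realType) (n : nat) (P : 'M[R]_n)
    (ev : 'I_n -> R) (phi : 'I_n -> 'cV[R]_n) : Prop := OrderedEigenbasis {
  eigenbasis_eigen : forall k, P *m phi k = ev k *: phi k;
  eigenbasis_orthonormal : forall j k, inner (phi j) (phi k) = (j == k)%:R;
  eigenbasis_sorted : forall j k : 'I_n, (j <= k)%N -> `|ev k| <= `|ev j|;
  eigenbasis_ev_first : forall k : 'I_n, k = 0%N :> nat -> `|ev k| = 1;
  eigenbasis_phi_first : forall k : 'I_n, k = 0%N :> nat ->
    phi k = const_mx (1 / Num.sqrt n%:R)
}.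

Definition in_X (R : realType) (n : nat) (ev : 'I_n -> R)
    (phi : 'I_n -> 'cV[R]_n) (lambda : R) (f : 'cV[R]_n) : Prop :=
  f = \sum_(k | lambda <= `|ev k|) inner f (phi k) *: phi k.

Definition X_norm (R : realType) (n : nat) (ev : 'I_n -> R)
    (phi : 'I_n -> 'cV[R]_n) (lambda : R) (f : 'cV[R]_n) : R :=
  Num.sqrt (\sum_(k | lambda <= `|ev k|) `|inner f (phi k)| ^+ 2).

(* Main.v *)
Require Import Defs.
From HB Require Import structures.
From mathcomp Require Import all_boot all_order all_algebra.
From mathcomp Require Import reals.
From mathcomp Require Import ring.
Set Implicit Arguments.
Unset Strict Implicit.
Unset Printing Implicit Defensive.
Import Order.TTheory GRing.Theory Num.Theory.
Local Open Scope ring_scope.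

(** Expand [f] and [mu := \sum_(w in W) a w *: dirac R w] in the eigenbasis.
    Since [mu] has total mass 1, its coefficient on the constant eigenvector is
    [1 / sqrt n], so the average of [f] is the first term of the expansion of
    [inner f mu] and the quadrature error is the sum of the remaining terms.
    For the eigenvalues seen by [f], the coefficient of [P ^+ l *m mu] is at
    least [lambda ^+ l] times that of [mu]; Cauchy-Schwarz and Parseval applied
    to [P ^+ l *m mu] conclude, the [- 1 / n] being its constant mode. *)

(** Lagrange's identity: the double sum of the squares [(x i * y j - x j * y i) ^+ 2] is twice the
    difference of the two sides. *)
Lemma cauchy_schwarz_sum (R : realDomainType) (I : finType) (P : pred I)
    (x y : I -> R) :
  (\sum_(i | P i) x i * y i) ^+ 2
  <= (\sum_(i | P i) x i ^+ 2) * (\sum_(i | P i) y i ^+ 2).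
Proof.
set S := _ ^+ 2; set T := _ * _.
have eqS : \sum_(i | P i) \sum_(j | P j) (x i * y i) * (x j * y j) = S.
  by rewrite /S expr2 big_distrlr.
have eqT : \sum_(i | P i) \sum_(j | P j) x i ^+ 2 * y j ^+ 2 = T.
  by rewrite /T big_distrlr.
have : 0 <= \sum_(i | P i) \sum_(j | P j) (x i * y j - x j * y i) ^+ 2.
  by apply: sumr_ge0 => i _; apply: sumr_ge0 => j _; apply: sqr_ge0.
have -> : \sum_(i | P i) \sum_(j | P j) (x i * y j - x j * y i) ^+ 2
    = (T - S) *+ 2.
  rewrite mulr2n -{1}eqT [in X in _ + X]/T mulrC big_distrlr /= -eqS.
  rewrite -!sumrB -big_split /=; apply: eq_bigr => i _.
  rewrite -!sumrB -big_split /=; apply: eq_bigr => j _.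
  by ring.
by rewrite pmulrn_lge0 // subr_ge0.
Qed.

Lemma innerC (R : realType) (n : nat) (f g : 'cV[R]_n) : inner f g = inner g f.
Proof. by apply: eq_bigr => v _; rewrite mulrC. Qed.

Lemma inner_sumZl (R : realType) (n : nat) (I : finType) (P : pred I)
    (c : I -> R) (F : I -> 'cV[R]_n) (g : 'cV[R]_n) :
  inner (\sum_(i | P i) c i *: F i) g = \sum_(i | P i) c i * inner (F i) g.
Proof.
rewrite /inner.
under eq_bigr do rewrite summxE mulr_suml.
rewrite exchange_big /=; apply: eq_bigr => i _.
by rewrite mulr_sumr; apply: eq_bigr => v _; rewrite mxE mulrA.
Qed.

Lemma inner_dirac (R : realType) (n : nat) (w : 'I_n) (g : 'cV[R]_n) :
  inner (dirac R w) g = g w 0.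
Proof.
rewrite /inner (bigD1 w) //= big1 => [|v /negbTE vw]; rewrite mxE.
  by rewrite !eqxx mul1r addr0.
by rewrite vw mul0r.
Qed.

Lemma l2norm_sqr (R : realType) (n : nat) (f : 'cV[R]_n) :
  l2norm f ^+ 2 = inner f f.
Proof.
rewrite /l2norm sqr_sqrtr; last by apply: sumr_ge0 => v _; apply: sqr_ge0.
by apply: eq_bigr => v _; rewrite expr2.
Qed.

Section OrthonormalBasis.
Variables (R : realType) (n : nat) (phi : 'I_n -> 'cV[R]_n).
Hypothesis orthonormal_phi : forall j k, inner (phi j) (phi k) = (j == k)%:R.

(** Orthonormality says that the matrix [Q] with columns [phi k] satisfies [Q^T *m Q = 1]. As [Q] is
    square, also [Q *m Q^T = 1], and this identity applied to [f] is the expansion. *)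
Lemma orthonormal_expansion (f : 'cV[R]_n) :
  f = \sum_k inner f (phi k) *: phi k.
Proof.
pose Q : 'M[R]_n := \matrix_(v, k) phi k v 0.
have /mulmx1C QQT : Q^T *m Q = 1%:M.
  apply/matrixP => j k; rewrite !mxE -orthonormal_phi.
  by apply: eq_bigr => v _; rewrite !mxE.
rewrite -[LHS]mul1mx -QQT -mulmxA; apply/matrixP => v z; rewrite ord1.
rewrite summxE mxE; apply: eq_bigr => k _; rewrite !mxE mulrC; congr (_ * _).
by apply: eq_bigr => u _; rewrite !mxE mulrC.
Qed.

Lemma parseval (f g : 'cV[R]_n) :
  inner f g = \sum_k inner f (phi k) * inner g (phi k).
Proof.
rewrite {1}[f]orthonormal_expansion inner_sumZl.
by apply: eq_bigr => k _; rewrite (innerC g).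
Qed.

Lemma inner_orthonormal_sum (P : pred 'I_n) (c : 'I_n -> R) (k : 'I_n) :
  inner (\sum_(j | P j) c j *: phi j) (phi k) = if P k then c k else 0.
Proof.
rewrite inner_sumZl; case: ifP => Pk.
  rewrite (bigD1 k) //= orthonormal_phi eqxx mulr1 big1 ?addr0 // => j.
  by case/andP=> _ /negbTE jk; rewrite orthonormal_phi jk mulr0.
rewrite big1 // => j Pj; rewrite orthonormal_phi.
by case: eqP Pj => [->|_]; rewrite ?Pk ?mulr0.
Qed.

(** Each [phi j] is an eigenvector of [P ^+ l] for [ev j ^+ l], so [P ^+ l] acts diagonally on the
    expansion of [f]. *)
Lemma inner_mx_exp_eigen (P : 'M[R]_n) (ev : 'I_n -> R) (l : nat)
    (f : 'cV[R]_n) (k : 'I_n) (eigen_phi : forall j, P *m phi j = ev j *: phi j) :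
  inner (P ^+ l *m f) (phi k) = ev k ^+ l * inner f (phi k).
Proof.
have eigenX j : P ^+ l *m phi j = ev j ^+ l *: phi j.
  elim: l => [|l IHl]; first by rewrite !expr0 mul1mx scale1r.
  by rewrite exprS -[P * _]/(P *m _) -mulmxA IHl -scalemxAr eigen_phi scalerA
    exprSr.
rewrite {1}[f]orthonormal_expansion mulmx_sumr.
under eq_bigr do rewrite -scalemxAr eigenX scalerA.
by rewrite (inner_orthonormal_sum predT) mulrC.
Qed.

End OrthonormalBasis.

Theorem mainTheorem1 (R : realType) (n : nat) (G : wgraph R n)
    (G_connected : connected_graph G) (dmax_gt0 : 0 < dmax G)
    (ev : 'I_n -> R) (phi : 'I_n -> 'cV[R]_n)
    (eigP : ordered_eigenbasis (1%:M + laplacian G) ev phi)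
    (W : {set 'I_n}) (a : 'I_n -> R) (sum_a : \sum_(w in W) a w = 1)
    (l : nat) (lambda : R) (lambda_gt0 : 0 < lambda) (lambda_lt1 : lambda < 1)
    (f : 'cV[R]_n) (fX : in_X ev phi lambda f) :
  `| 1 / n%:R * (\sum_v f v 0) - \sum_(w in W) a w * f w 0 |
  <= X_norm ev phi lambda f / lambda ^+ l
     * Num.sqrt (l2norm ((1%:M + laplacian G) ^+ l
                         *m (\sum_(w in W) a w *: dirac R w)) ^+ 2
                 - 1 / n%:R).
Proof.
case: eigP => eigen_phi ortho _ ev_first phi_first.
set mu := \sum_(w in W) a w *: dirac R w.
pose c k := inner mu (phi k); pose d k := inner f (phi k).
(* The vertex set is nonempty: for [n = 0] the weights would have the empty sum 0 instead of 1. *)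
have [k0 k0E] : exists k0 : 'I_n, k0 = 0%N :> nat.
  case: n W a sum_a {G G_connected dmax_gt0 ev phi f fX eigen_phi ortho ev_first
    phi_first mu c d} => [W a|m *]; last by exists ord0.
  by rewrite big1 => [/esym/eqP|[]//]; rewrite oner_eq0.
have ev0 := ev_first _ k0E.
have sqrtn2 : (1 / Num.sqrt n%:R) * (1 / Num.sqrt n%:R) = 1 / n%:R :> R.
  by rewrite !mul1r -invfM -expr2 sqr_sqrtr ?ler0n.
have c0 : c k0 = 1 / Num.sqrt n%:R.
  transitivity ((\sum_(w in W) a w) * (1 / Num.sqrt n%:R)); last first.
    by rewrite sum_a mul1r.
  rewrite /c inner_sumZl phi_first // mulr_suml.
  by apply: eq_bigr => w _; rewrite inner_dirac mxE.
have d0 : d k0 = (\sum_v f v 0) * (1 / Num.sqrt n%:R).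
  by rewrite /d phi_first // mulr_suml; apply: eq_bigr => v _; rewrite mxE.
have dE k : ~~ (lambda <= `|ev k|) -> d k = 0.
  by move=> /negbTE lk; rewrite /d fX inner_orthonormal_sum // lk.
(* The modes that contribute to the error: below the threshold [d k] vanishes, and the constant mode
   cancels against the average. *)
pose Q k := (lambda <= `|ev k|) && (k != k0).
have errE : 1 / n%:R * (\sum_v f v 0) - \sum_(w in W) a w * f w 0
    = - \sum_(k | Q k) d k * c k.
  have -> : \sum_(w in W) a w * f w 0 = inner f mu.
    by rewrite innerC inner_sumZl; apply: eq_bigr => w _; rewrite inner_dirac.
  rewrite (parseval ortho) [X in _ - X](bigD1 k0) //= -/(d k0) -/(c k0) d0 c0.
  rewrite -[X in _ - (X + _)]mulrA sqrtn2.
  rewrite mulrC opprD addNKr; congr (- _).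
  rewrite (bigID (fun k => lambda <= `|ev k|)) /= addrC big1 ?add0r.
    by apply: eq_bigl => k; rewrite /Q andbC.
  by move=> k /andP[_ /dE]; rewrite /d => ->; rewrite mul0r.
have normE : l2norm ((1%:M + laplacian G) ^+ l *m mu) ^+ 2 - 1 / n%:R
    = \sum_(k | k != k0) (ev k ^+ l * c k) ^+ 2.
  rewrite l2norm_sqr (parseval ortho) (bigD1 k0) //=.
  under eq_bigr do rewrite (inner_mx_exp_eigen ortho _ _ _ eigen_phi) -expr2.
  rewrite (inner_mx_exp_eigen ortho _ _ _ eigen_phi) -/(c k0) c0.
  (* Only the absolute value of [ev k0] is known to be 1, so its powers are regrouped as powers of
     its square. *)
  rewrite mulrACA sqrtn2 -expr2 -exprM mulnC exprM.
  by rewrite -real_normK ?num_real // ev0 !expr1n mul1r addrAC subrr add0r.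
have sum_sqr_ge0 (S : pred 'I_n) (x : 'I_n -> R) : 0 <= \sum_(k | S k) x k ^+ 2.
  by apply: sumr_ge0 => k _; apply: sqr_ge0.
have dQ : \sum_(k | Q k) d k ^+ 2
    <= \sum_(k | lambda <= `|ev k|) `|inner f (phi k)| ^+ 2.
  rewrite [leRHS](bigID (fun k => k != k0)) /=.
  under [X in X + _]eq_bigr do rewrite real_normK ?num_real //.
  by rewrite lerDl.
(* The modes below the threshold only enlarge the right-hand side; on the others [lambda ^+ l] is at
   most the absolute value of [ev k ^+ l]. *)
have cQ : \sum_(k | Q k) c k ^+ 2
    <= (\sum_(k | k != k0) (ev k ^+ l * c k) ^+ 2) / lambda ^+ l ^+ 2.
  rewrite ler_pdivlMr ?exprn_gt0 // mulr_suml.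
  rewrite [leRHS](bigID (fun k => lambda <= `|ev k|)) /=.
  rewrite (eq_bigl (fun k => (k != k0) && (lambda <= `|ev k|))); last first.
    by move=> k; rewrite /Q andbC.
  rewrite -[leLHS]addr0; apply: lerD => //; apply: ler_sum => k /andP[_ lk].
  rewrite exprMn mulrC ler_wpM2r ?sqr_ge0 //.
  rewrite -[leRHS]real_normK ?num_real // normrX.
  by rewrite !lerXn2r ?nnegrE ?exprn_ge0 // ltW.
rewrite errE normE normrN -sqrtr_sqr.
have lam_ge0 : 0 <= lambda ^+ l by rewrite exprn_ge0 // ltW.
(* With [lambda ^+ l] written as a root, both sides become single square roots, and it remains to
   compare the radicands by Cauchy-Schwarz, [dQ] and [cQ]. *)
have lamE : lambda ^+ l = Num.sqrt (lambda ^+ l ^+ 2).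
  by rewrite sqrtr_sqr ger0_norm.
rewrite /X_norm -mulrA [in leRHS]lamE -sqrtrV ?sqr_ge0 //.
rewrite -sqrtrM ?invr_ge0 ?sqr_ge0 // -sqrtrM; last first.
  by apply: sumr_ge0 => k _; apply: sqr_ge0.
apply: ler_wsqrtr; apply: le_trans (cauchy_schwarz_sum _ _ _) _.
by rewrite [_^-1 * _]mulrC ler_pM.
Qed.
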